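(* Let $\underline{d}=(\underline{d}_0,\underline{d}_1,\dots,\underline{d}_p)$ and $\overline{d}=(\overline{d}_0,\overline{d}_1,\dots,\overline{d}_p)$ be two strictly increasing sequences of integers such that $\underline{d}\le\overline{d}$, that is, $\underline{d}_i\le\overline{d}_i$ for all $i$. Assume that $\underline{d}_0=\overline{d}_0=0$ and that $D\in V_{\underline{d},\overline{d}}$ is in the convex hull (over $\mathbb{Q}$) of $\varPi_{\underline{d},\overline{d}}$. Then $$\prod_{i=1}^p\underline{d}_i\le p!\,e(D)\le\prod_{i=1}^p\overline{d}_i,$$ with equality below or above if and only if $D$ is a pure diagram.
   Context: $V_{\underline{d},\overline{d}}$ is the $\mathbb{Q}$-vector space of rational matrices $D=(D_{i,j})$, $0\le i\le p$, $j\in\mathbb{Z}$ (called diagrams of codimension $p$), with $D_{i,j}=0$ whenever $j<\underline{d}_i$ or $j>\overline{d}_i$, and with $\sum_{i,j}(-1)^i j^m D_{i,j}=0$ for $m=0,1,\dots,p-1$ (convention $0^0=1$). For such $D$ put $S_D(t)=\sum_{i,j}(-1)^iD_{i,j}t^j$; it is divisible by $(1-t)^p$, the $h$-vector is $h_D(t)=S_D(t)/(1-t)^p$, and the multiplicity is $e(D)=h_D(1)$. For a strictly increasing integer sequence $d=(d_0,\dots,d_p)$, the pure diagram $\pi(d)$ is the matrix with $\pi(d)_{i,j}=0$ for $j\ne d_i$, $\pi(d)_{0,d_0}=1$, and $\pi(d)_{i,d_i}=(-1)^{i+1}\prod_{1\le k\le p,\,k\ne i}\frac{d_k-d_0}{d_k-d_i}$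 for $1\le i\le p$. A pure diagram is a matrix of the form $\pi(d)$ for some such $d$. $\varPi_{\underline{d},\overline{d}}$ is the set of all pure diagrams in $V_{\underline{d},\overline{d}}$, that is, all $\pi(d)$ with $d$ strictly increasing and $\underline{d}_i\le d_i\le\overline{d}_i$ for all $i$.
   Formalization: ''Equality iff D is pure'' fails for p=1, bounds (0,1),(0,3), D=π(0,2); it is replaced by: equality below iff D=π(d̲), above iff D=π(d̄), and ''iff D is pure'' for each bound when d̲_i and d̄_i are the extreme degrees of nonzero entries in each row of D. *)

(* Defs.v *)
From mathcomp Require Export all_boot all_order all_algebra.
From mathcomp Require Export boolp classical_sets cardinality fsbigop.

Set Implicit Arguments.
Unset Strict Implicit.
Unset Printing Implicit Defensive.

Import Order.TTheory GRing.Theory Num.Theory.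

Local Open Scope classical_set_scope.
Local Open Scope ring_scope.

Definition diagram (p : nat) := 'I_p.+1 -> int -> rat.

Definition strictly_increasing (p : nat) (d : 'I_p.+1 -> int) : Prop :=
  forall i j : 'I_p.+1, (i < j)%N -> d i < d j.

(* The Q-vector space of diagrams of codimension p with support in the window
   [lo, hi], written V_{lo,hi} below. The support condition makes the inner sums
   of the moment conditions finite; [\sum_(j \in A)] is 0 on infinite supports.
   For m = 0 the factor j ^+ m is 1, also at j = 0. *)
Definition diagram_space (p : nat) (lo hi : 'I_p.+1 -> int) :
    set (diagram p) :=
  [set D | (forall i j, (j < lo i) || (hi i < j) -> D i j = 0) /\
           (forall m : nat, (m < p)%N ->
              \sum_(i < p.+1) \sum_(j \in [set: int])
                (-1) ^+ i * (j%:~R : rat) ^+ m * D i j = 0)].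

(* S_D as a polynomial: only nonnegative degrees j are summed, which is all of
   S_D as soon as D is supported in nonnegative degrees, as for every D in
   V_{lo,hi} when lo is increasing with lo 0 = 0. *)
Definition S_poly (p : nat) (D : diagram p) : {poly rat} :=
  \sum_(i < p.+1) \sum_(j \in [set: nat]) ((-1) ^+ i * D i j%:Z) *: 'X^j.

(* For D in V_{lo,hi} with lo 0 = 0 this division is exact. *)
Definition h_vector (p : nat) (D : diagram p) : {poly rat} :=
  S_poly D %/ (1 - 'X) ^+ p.

Definition multiplicity (p : nat) (D : diagram p) : rat := (h_vector D).[1].

Definition pure_diagram (p : nat) (d : 'I_p.+1 -> int) : diagram p :=
  fun i j =>
    if j != d i then 0
    else if i == ord0 then 1
    else (-1) ^+ i.+1 *
         \prod_(k < p.+1 | (k != ord0) && (k != i))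
            ((d k - d ord0)%:~R / (d k - d i)%:~R).

Definition is_pure (p : nat) (D : diagram p) : Prop :=
  exists2 d : 'I_p.+1 -> int, strictly_increasing d & D = pure_diagram d.

Definition pure_diagrams (p : nat) (lo hi : 'I_p.+1 -> int) :
    set (diagram p) :=
  [set D | exists d : 'I_p.+1 -> int,
     [/\ strictly_increasing d, forall i, lo i <= d i <= hi i
       & D = pure_diagram d]].

(* Convex hull over the rationals, in the rational vector space of matrices with
   entrywise operations. *)
Definition convex_hull (p : nat) (A : set (diagram p)) : set (diagram p) :=
  [set D | exists (n : nat) (c : 'I_n -> rat) (v : 'I_n -> diagram p),
     [/\ forall k, 0 <= c k, \sum_(k < n) c k = 1, forall k, A (v k)
       & forall i j, D i j = \sum_(k < n) c k * v k i j]].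

(* lo i and hi i are the least and greatest degrees of nonzero entries in row i
   of D, given that D vanishes outside the window [lo, hi]. *)
Definition tight_window (p : nat) (lo hi : 'I_p.+1 -> int) (D : diagram p) :
    Prop :=
  forall i, D i (lo i) != 0 /\ D i (hi i) != 0.

(* Main.v *)
Require Import Defs.

Set Implicit Arguments.
Unset Strict Implicit.
Unset Printing Implicit Defensive.

Import Order.TTheory GRing.Theory Num.Theory.
Local Open Scope ring_scope.

(** Write [x_i] for the degrees of a pure diagram [pi(d)] with [d_0 = 0].  Its
    signed entries [(-1)^i pi(d)_(i,d_i)] are, up to the common factor
    [(-1)^p P] with [P = d_1 ... d_p], the weights [w_i = prod_(k <> i)
    (x_i - x_k)^-1] of the divided difference at [x_0, ..., x_p]
    ([signed_pure_entry]).  A divided difference sends a polynomial [f] of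
    degree at most [p] to its coefficient of degree [p] ([divided_difference]).
    Expanding [S_pi(d)(t)] in powers of [1 - t], the coefficient of [(1 - t)^m]
    is [(-1)^m sum_i (-1)^i pi(d)_(i,d_i) 'C(d_i, m)], and [m! 'C(x, m)] is a
    monic polynomial in [x] of degree [m].  So these coefficients vanish for
    [m < p], and the one at [m = p], which is [e(pi(d))], equals [P / p!]
    ([multiplicity_pure]).

    The multiplicity is linear, hence [p! e(D)] is the average of the products
    [d_1 ... d_p], with the weights of a decomposition of [D] into pure diagrams.
    Each product lies between those of [lo] and [hi], whose factors of index
    [i >= 1] are positive.  If the average reaches one of these two bounds, then
    every product that carries a nonzero weight does ([average_eq_min],
    [average_eq_max]), and by positivity its factors agree with those of the
    bound ([prod_eq_factors]); so only the pure diagram of the extremal degree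
    sequence contributes.  When the window is tight, a pure [D] forces
    [lo = d = hi]. *)

(** * Divided differences *)

Definition divided_weight (F : fieldType) (n : nat) (x : 'I_n.+1 -> F)
    (i : 'I_n.+1) : F :=
  \prod_(k | k != i) (x i - x k)^-1.

Lemma size_prod_XsubC_neq (F : fieldType) (n : nat) (x : 'I_n.+1 -> F) i :
  size (\prod_(k | k != i) ('X - (x k)%:P)) = n.+1.
Proof.
rewrite -big_filter size_prod_XsubC size_filter.
by rewrite -[count _ _]sum1_count -/(index_enum _) sum1_card cardC1 card_ord.
Qed.

(** Lagrange interpolation at the nodes [x] recovers [f], and it is a combination
    of the monic polynomials [L i] of degree [n]: compare the coefficients of
    degree [n]. *)
Lemma divided_difference (F : fieldType) (n : nat) (x : 'I_n.+1 -> F)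
    (f : {poly F}) :
  injective x -> (size f <= n.+1)%N ->
  \sum_i divided_weight x i * f.[x i] = f`_n.
Proof.
move=> x_inj size_f.
pose L i : {poly F} := \prod_(k | k != i) ('X - (x k)%:P).
pose g := \sum_i (divided_weight x i * f.[x i]) *: L i.
have L_other i j : j != i -> (L i).[x j] = 0.
  by move=> neq_ji; rewrite /L horner_prod (bigD1 j) //= hornerXsubC subrr mul0r.
have L_self i : divided_weight x i * (L i).[x i] = 1.
  rewrite /divided_weight /L horner_prod -big_split big1 //= => k neq_ki.
  by rewrite hornerXsubC mulVf // subr_eq0 (inj_eq x_inj) eq_sym.
have g_x j : g.[x j] = f.[x j].
  rewrite /g horner_sum (bigD1 j) //= big1 => [|i neq_ij].
    by rewrite addr0 hornerZ mulrAC L_self mul1r.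
  by rewrite hornerZ L_other ?mulr0 // eq_sym.
have size_g : (size g <= n.+1)%N.
  apply: leq_trans (size_sum _ _ _) _; apply/bigmax_leqP => i _.
  by apply: leq_trans (size_scale_leq _ _) _; rewrite size_prod_XsubC_neq.
have /eqP : f - g = 0.
  apply: (@roots_geq_poly_eq0 _ _ [seq x i | i <- enum 'I_n.+1]).
  - by apply/allP => _ /mapP [i _ ->]; rewrite /root !hornerE g_x subrr.
  - by rewrite map_inj_uniq ?enum_uniq.
  - rewrite size_map size_enum_ord.
    by apply: leq_trans (size_polyD _ _) _; rewrite size_polyN geq_max size_f.
rewrite subr_eq0 => /eqP {2}->; rewrite /g coef_sum.
apply: eq_bigr => i _; rewrite coefZ.
have -> : (L i)`_n = lead_coef (L i).
  by rewrite /lead_coef size_prod_XsubC_neq.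
by rewrite lead_coef_prod_XsubC mulr1.
Qed.

(** * Expansion in powers of [1 - 'X] *)

Definition falling_poly (F : fieldType) (m : nat) : {poly F} :=
  \prod_(k < m) ('X - (k%:R)%:P).

Lemma size_falling_poly (F : fieldType) m : size (falling_poly F m) = m.+1.
Proof.
by rewrite /falling_poly size_prod_XsubC -[index_enum _]enumT size_enum_ord.
Qed.

Lemma horner_falling_poly (F : fieldType) m n :
  (falling_poly F m).[n%:R] = (n ^_ m)%:R.
Proof.
rewrite /falling_poly horner_prod ffact_prod.
have [le_mn | lt_nm] := leqP m n.
  rewrite natr_prod; apply: eq_bigr => k _.
  by rewrite hornerXsubC natrB // (leq_trans (ltnW (ltn_ord k))).
(* One factor vanishes on each side: the one with k = n. *)
rewrite (bigD1 (Ordinal lt_nm)) //= hornerXsubC subrr mul0r.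
by rewrite (bigD1 (Ordinal lt_nm)) //= subnn mul0n.
Qed.

Lemma expX_1subX (F : comNzRingType) (d N : nat) : (d < N)%N ->
  'X^d = \sum_(m < N) ((-1) ^+ m * ('C(d, m))%:R) *: (1 - 'X) ^+ m :> {poly F}.
Proof.
move=> lt_dN; rewrite -[in LHS](subKr 1 'X) exprBn.
pose t m : {poly F} := ((-1) ^+ m * ('C(d, m))%:R) *: (1 - 'X) ^+ m.
transitivity (\sum_(m < d.+1) t m).
  apply: eq_bigr => m _; rewrite /t expr1n mulr1 -mulr_natr -scalerA.
  rewrite scaler_nat -mul_polyC rmorphXn rmorphN1 mulr_natr.
  by rewrite mulrnAr.
rewrite (big_ord_widen N t) // [RHS](bigID (fun m : 'I_N => (m < d.+1)%N)) /=.
rewrite [X in _ = _ + X]big1 ?addr0 // => m; rewrite -leqNgt => lt_dm.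
by rewrite bin_small // mulr0 scale0r.
Qed.

(** The cofactor keeps the terms of exponent [m >= p] of the expansion in powers
    of [1 - 'X]; only the one with [m = p] survives at [1]. *)
Lemma factor_1subX (F : comNzRingType) (n p : nat) (s : 'I_n -> F)
    (d : 'I_n -> nat) :
  (forall m, (m < p)%N -> \sum_i s i * ('C(d i, m))%:R = 0) ->
  exists2 Q : {poly F}, \sum_i s i *: 'X^(d i) = Q * (1 - 'X) ^+ p
    & Q.[1] = (-1) ^+ p * \sum_i s i * ('C(d i, p))%:R.
Proof.
move=> moments0.
pose M := \max_i d i.
pose a m : F := (-1) ^+ m * \sum_i s i * ('C(d i, m))%:R.
exists (\sum_(j < M.+1) a (p + j)%N *: (1 - 'X) ^+ j); last first.
  rewrite horner_sum big_ord_recl big1 => [|j _].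
    by rewrite addr0 addn0 expr0 hornerZ hornerC mulr1.
  by rewrite hornerZ horner_exp !hornerE subrr exprS mul0r mulr0.
transitivity (\sum_(m < p + M.+1) a m *: (1 - 'X) ^+ m : {poly F}).
  under eq_bigr => i _.
    rewrite (@expX_1subX _ (d i) (p + M.+1)); last first.
      by rewrite addnS ltnS (leq_trans (leq_bigmax i)) // leq_addl.
    rewrite scaler_sumr; over.
  rewrite exchange_big /=; apply: eq_bigr => m _.
  rewrite /a mulr_sumr scaler_suml; apply: eq_bigr => i _.
  by rewrite scalerA mulrCA.
rewrite big_split_ord /= big1 ?add0r => [|m _].
  rewrite mulr_suml; apply: eq_bigr => j _.
  by rewrite -scalerAl -exprD addnC.
by rewrite /a moments0 // mulr0 scale0r.
Qed.

(** * The multiplicity of a pure diagram *)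

Section PureDiagram.

Variables (p : nat) (d : 'I_p.+1 -> int).
Hypothesis d_incr : strictly_increasing d.

Let x (i : 'I_p.+1) : rat := (d i)%:~R.

Lemma strictly_increasing_inj : injective d.
Proof.
move=> i j eq_d; apply/val_inj/eqP; case: ltngtP => // /d_incr;
by rewrite eq_d ltxx.
Qed.

Let x_inj : injective x.
Proof. by move=> i j /intr_inj /strictly_increasing_inj. Qed.

Lemma strictly_increasing_ge0 : d ord0 = 0 -> forall i, 0 <= d i.
Proof.
move=> d0 i; rewrite -d0; case: (posnP i) => [i0 | i_gt0].
  by rewrite (_ : i = ord0) //; apply: val_inj.
by apply/ltW/d_incr.
Qed.

Lemma strictly_increasing_gt0 : d ord0 = 0 -> forall i, i != ord0 -> 0 < d i.
Proof. by move=> d0 i i_neq0; rewrite -d0 d_incr // lt0n. Qed.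

(** The case distinction in the definition of a pure diagram normalises row 0
    to 1.  Up to one scalar all rows have the same form, so sums over the
    entries are divided differences. *)
Lemma signed_pure_entry (i : 'I_p.+1) :
  (-1) ^+ i * pure_diagram d i (d i) =
  (-1) ^+ p * (\prod_(k | k != ord0) (x k - x ord0)) * divided_weight x i.
Proof.
have x_neq k l : k != l -> x k - x l != 0.
  by move=> neq; rewrite subr_eq0 (inj_eq x_inj).
have -> : divided_weight x i = (-1) ^+ p * \prod_(k | k != i) (x k - x i)^-1.
  rewrite /divided_weight; under eq_bigr do rewrite -opprB invrN.
  by rewrite (prodrN (fun k => k != i)) cardC1 card_ord.
rewrite mulrACA -expr2 sqrr_sign mul1r /pure_diagram eqxx /=.
case: eqVneq => [-> | i_neq0].
  rewrite mulr1 prodfV divff //.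
  by apply/prodf_neq0 => k; apply: x_neq.
under eq_bigr do rewrite !rmorphB.
(* The signs (-1)^i and (-1)^(i+1) leave -1, which the factor x 0 - x i of the
   weight, opposite to x i - x 0, absorbs. *)
rewrite prodf_div mulrA -exprD addnS addnn -mul2n exprS exprM sqrrN.
rewrite !expr1n mulr1 mulN1r [in RHS](bigD1 i) //=.
rewrite [\prod_(k | k != i) _](bigD1 ord0) 1?eq_sym //=.
rewrite prodfV -[x ord0 - x i]opprB invrN mulrACA mulrN divff ?x_neq // mulN1r.
by under [X in _ = - (_ / X)]eq_bigl do rewrite andbC.
Qed.

(** The vanishing below order [p] expresses the divisibility of [S_pi(d)] by
    [(1 - t)^p]; the value at order [p] is its multiplicity. *)
Lemma pure_binomial_moment m : d ord0 = 0 -> (m <= p)%N ->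
  \sum_(i < p.+1) (-1) ^+ i * pure_diagram d i (d i) * ('C(`|d i|, m))%:R =
  (m == p)%:R * (-1) ^+ p / p`!%:R * \prod_(k | k != ord0) x k.
Proof.
move=> d0 le_mp; set P := \prod_(k | _) _.
have fact_neq0 n : n`!%:R != 0 :> rat by rewrite pnatr_eq0 -lt0n fact_gt0.
apply: (mulIf (fact_neq0 m)); rewrite mulr_suml.
transitivity (\sum_i (-1) ^+ p * P *
                (divided_weight x i * (falling_poly rat m).[x i])).
  apply: eq_bigr => i _; rewrite -[LHS]mulrA -natrM bin_ffact signed_pure_entry.
  rewrite -horner_falling_poly natr_absz ger0_norm ?strictly_increasing_ge0 //.
  rewrite -[LHS]mulrA; congr (_ * _ * _).
  by apply: eq_bigr => k _; rewrite {2}/x d0 subr0.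
rewrite -mulr_sumr divided_difference ?size_falling_poly //.
case: eqVneq => [-> | neq_mp]; last first.
  by rewrite nth_default ?mulr0 ?mul0r // size_falling_poly ltn_neqAle neq_mp.
have -> : (falling_poly rat p)`_p = 1.
  rewrite -[RHS](lead_coef_prod_XsubC (index_enum 'I_p) xpredT (fun k => k%:R)).
  by rewrite /lead_coef size_falling_poly.
by rewrite mulr1 mul1r mulrAC divfK.
Qed.

End PureDiagram.

(** This replaces the sum over all natural numbers by a sum up to any bound [N]
    beyond the support, so that a common [N] serves for several diagrams. *)
Lemma S_polyE (p N : nat) (D : diagram p) :
  (forall i (j : nat), (N <= j)%N -> D i j = 0) ->
  S_poly D = \sum_(i < p.+1) \sum_(j < N) ((-1) ^+ i * D i j) *: 'X^j.
Proof.
move=> D0; rewrite /S_poly; apply: eq_bigr => i _.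
rewrite (fsbig_ord _ _ (fun j : nat => ((-1) ^+ i * D i j) *: 'X^j)).
apply/esym/fsbig_widen => // j [_ /= /negP].
by rewrite -leqNgt => le_Nj; rewrite /preimage /= D0 // mulr0 scale0r.
Qed.

Lemma pure_diagram_eq0 (p : nat) (d : 'I_p.+1 -> int) i j :
  j != d i -> pure_diagram d i j = 0.
Proof. by rewrite /pure_diagram => ->. Qed.

Lemma S_poly_pure (p : nat) (d : 'I_p.+1 -> int) : (forall i, 0 <= d i) ->
  S_poly (pure_diagram d) =
  \sum_(i < p.+1) ((-1) ^+ i * pure_diagram d i (d i)) *: 'X^`|d i|.
Proof.
move=> d_ge0; rewrite (@S_polyE _ (\max_i `|d i|).+1); last first.
  move=> i j lt_dj; rewrite /pure_diagram ifT //; apply: contraTneq lt_dj => eq_j.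
  by rewrite -leqNgt -[j]/(`|j|%N) eq_j leq_bigmax.
apply: eq_bigr => i _.
have lt_d : (`|d i| < (\max_i `|d i|).+1)%N by rewrite ltnS leq_bigmax.
rewrite (bigD1 (Ordinal lt_d)) //= big1 => [|j neq_j].
  by rewrite gez0_abs ?addr0.
rewrite {1}/pure_diagram ifT ?mulr0 ?scale0r //.
by apply: contraNneq neq_j => /(congr1 absz) /= eq_j; apply/eqP/val_inj.
Qed.

Lemma oneBX_exp_neq0 p : (1 - 'X) ^+ p != 0 :> {poly rat}.
Proof. by rewrite expf_neq0 // -opprB oppr_eq0 polyXsubC_eq0. Qed.

Lemma S_poly_pure_factor (p : nat) (d : 'I_p.+1 -> int) :
  strictly_increasing d -> d ord0 = 0 ->
  exists2 Q : {poly rat}, S_poly (pure_diagram d) = Q * (1 - 'X) ^+ p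
    & p`!%:R * Q.[1] = \prod_(i < p.+1 | i != ord0) (d i)%:~R.
Proof.
move=> d_incr d0.
have [|Q SQ Q1] := @factor_1subX rat p.+1 p
  (fun i => (-1) ^+ i * pure_diagram d i (d i)) (fun i => `|d i|%N).
  move=> m lt_mp; rewrite (pure_binomial_moment d_incr d0 (ltnW lt_mp)).
  by rewrite (ltn_eqF lt_mp) !mul0r.
exists Q; first by rewrite S_poly_pure //; apply: strictly_increasing_ge0.
have fact_neq0 : p`!%:R != 0 :> rat by rewrite pnatr_eq0 -lt0n fact_gt0.
rewrite Q1 (pure_binomial_moment d_incr d0 (leqnn p)) eqxx mul1r.
by rewrite -mulrA signrMK mulVKf.
Qed.

(** * The multiplicity on the convex hull *)

(** Each pure diagram contributes an exact quotient, so dividing the combination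
    by [(1 - 'X) ^+ p] amounts to combining these quotients. *)
Lemma multiplicity_combination (p n : nat) (c : 'I_n -> rat)
    (d : 'I_n -> 'I_p.+1 -> int) (D : diagram p) :
  (forall k, strictly_increasing (d k)) -> (forall k, d k ord0 = 0) ->
  (forall i j, D i j = \sum_(k < n) c k * pure_diagram (d k) i j) ->
  p`!%:R * multiplicity D =
  \sum_(k < n) c k * \prod_(i < p.+1 | i != ord0) (d k i)%:~R.
Proof.
move=> d_incr d0 DE.
have [Q SQ Q1] :=
  fin_all_exists2 (fun k => S_poly_pure_factor (d_incr k) (d0 k)).
have SD : S_poly D = \sum_(k < n) c k *: S_poly (pure_diagram (d k)).
  pose N := (\max_k \max_i `|d k i|).+1.
  have pure0 k i (j : nat) : (N <= j)%N -> pure_diagram (d k) i j = 0.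
    move=> le_Nj; apply: pure_diagram_eq0; apply: contraTneq le_Nj => eq_j.
    rewrite -leqNgt -[j]/(`|j|%N) eq_j (leq_trans _ (leq_bigmax k)) //.
    exact: (leq_bigmax (F := fun i => `|d k i|%N)).
  rewrite (@S_polyE p N) => [|i j le_Nj]; last first.
    by rewrite DE big1 // => k _; rewrite pure0 // mulr0.
  under [RHS]eq_bigr => k _.
    rewrite (S_polyE (pure0 k)) scaler_sumr.
    under eq_bigr do rewrite scaler_sumr.
    over.
  rewrite [RHS]exchange_big; apply: eq_bigr => i _ /=.
  rewrite [RHS]exchange_big; apply: eq_bigr => j _ /=.
  rewrite DE mulr_sumr scaler_suml; apply: eq_bigr => k _.
  by rewrite scalerA mulrCA.
rewrite /multiplicity /h_vector SD.
under eq_bigr do rewrite SQ scalerAl.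
rewrite -mulr_suml mulpK ?oneBX_exp_neq0 // horner_sum mulr_sumr.
by apply: eq_bigr => k _; rewrite hornerZ mulrCA Q1.
Qed.

Lemma multiplicity_pure (p : nat) (d : 'I_p.+1 -> int) :
  strictly_increasing d -> d ord0 = 0 ->
  p`!%:R * multiplicity (pure_diagram d) =
  \prod_(i < p.+1 | i != ord0) (d i)%:~R.
Proof.
move=> d_incr d0.
rewrite (@multiplicity_combination p 1 (fun=> 1) (fun=> d)) //.
  by rewrite big_ord1 mul1r.
by move=> i j; rewrite big_ord1 mul1r.
Qed.

(** * Extremal averages and products *)

Section Average.

Variables (R : realDomainType) (n : nat) (c f : 'I_n -> R) (b : R).
Hypotheses (c_ge0 : forall k, 0 <= c k) (c_sum1 : \sum_(k < n) c k = 1).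

Lemma average_subr : \sum_(k < n) c k * f k - b = \sum_(k < n) c k * (f k - b).
Proof.
under [RHS]eq_bigr do rewrite mulrBr.
by rewrite sumrB -mulr_suml c_sum1 mul1r.
Qed.

Lemma average_ge : (forall k, b <= f k) -> b <= \sum_(k < n) c k * f k.
Proof.
move=> f_ge; rewrite -subr_ge0 average_subr sumr_ge0 // => k _.
by rewrite mulr_ge0 ?subr_ge0.
Qed.

(** The deviations [f k - b] are nonnegative and their weighted sum is zero. *)
Lemma average_eq_min : (forall k, b <= f k) ->
  \sum_(k < n) c k * f k = b -> forall k, c k != 0 -> f k = b.
Proof.
move=> f_ge /eqP; rewrite -subr_eq0 average_subr => /eqP sum0 k ck_neq0.
have terms_ge0 i : true -> 0 <= c i * (f i - b).
  by move=> _; rewrite mulr_ge0 ?subr_ge0.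
have /eqP : c k * (f k - b) = 0 by apply: (psumr_eq0P terms_ge0 sum0).
by rewrite mulf_eq0 (negPf ck_neq0) subr_eq0 => /eqP.
Qed.

End Average.

Section AverageOpp.

Variables (R : realDomainType) (n : nat) (c f : 'I_n -> R) (b : R).
Hypotheses (c_ge0 : forall k, 0 <= c k) (c_sum1 : \sum_(k < n) c k = 1).

Lemma average_opp :
  \sum_(k < n) c k * - f k = - \sum_(k < n) c k * f k.
Proof. by rewrite -sumrN; apply: eq_bigr => k _; rewrite mulrN. Qed.

Lemma average_le : (forall k, f k <= b) -> \sum_(k < n) c k * f k <= b.
Proof.
by move=> f_le; rewrite -lerN2 -average_opp average_ge // => k; rewrite lerN2.
Qed.

Lemma average_eq_max : (forall k, f k <= b) ->
  \sum_(k < n) c k * f k = b -> forall k, c k != 0 -> f k = b.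
Proof.
move=> f_le sum_b k ck_neq0; apply: oppr_inj.
apply: (average_eq_min (c := c) (f := fun k => - f k)) => // [i|].
  by rewrite lerN2.
by rewrite average_opp sum_b.
Qed.

End AverageOpp.

(** Replacing one factor by a strictly larger one increases a product of
    positive factors strictly. *)
Lemma prod_eq_factors (R : realDomainType) (I : finType) (P : pred I)
    (a b : I -> R) :
  (forall i, P i -> 0 < a i <= b i) ->
  \prod_(i | P i) a i = \prod_(i | P i) b i -> forall i, P i -> a i = b i.
Proof.
move=> ab eq_prod i Pi; have /andP [ai_gt0 le_i] := ab i Pi.
apply/eqP; rewrite eq_le le_i leNgt; apply/negP => lt_i.
have: \prod_(i | P i) a i < \prod_(i | P i) b i.
  rewrite !(bigD1 i Pi) /=.
  apply: (@lt_le_trans _ _ (b i * \prod_(j | P j && (j != i)) a j)).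
    rewrite ltr_pM2r // prodr_gt0 // => j /andP [Pj _].
    by case/andP: (ab j Pj).
  rewrite ler_pM2l ?(lt_le_trans ai_gt0) // ler_prod // => j /andP [Pj _].
  by case/andP: (ab j Pj) => /ltW ->.
by rewrite eq_prod ltxx.
Qed.

Lemma prod_degrees_le (p : nat) (a b : 'I_p.+1 -> int) :
  strictly_increasing a -> a ord0 = 0 -> (forall i, a i <= b i) ->
  \prod_(i < p.+1 | i != ord0) (a i)%:~R
    <= \prod_(i < p.+1 | i != ord0) (b i)%:~R :> rat.
Proof.
move=> a_incr a0 le_ab; apply: ler_prod => i i_neq0.
by rewrite ler0z ler_int le_ab strictly_increasing_ge0.
Qed.

Lemma prod_degrees_inj (p : nat) (a b : 'I_p.+1 -> int) :
  strictly_increasing a -> a ord0 = 0 -> b ord0 = 0 ->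
  (forall i, a i <= b i) ->
  \prod_(i < p.+1 | i != ord0) (a i)%:~R
    = \prod_(i < p.+1 | i != ord0) (b i)%:~R :> rat ->
  a = b.
Proof.
move=> a_incr a0 b0 le_ab eq_prod; apply: funext => i.
case: (eqVneq i ord0) => [-> | i_neq0]; first by rewrite a0 b0.
apply: (@intr_inj rat).
apply: (prod_eq_factors _ eq_prod i_neq0) => j j_neq0.
by rewrite ltr0z ler_int le_ab (strictly_increasing_gt0 a_incr).
Qed.

Lemma combination_same (p n : nat) (c : 'I_n -> rat)
    (v : 'I_n -> diagram p) (D E : diagram p) :
  \sum_(k < n) c k = 1 ->
  (forall i j, D i j = \sum_(k < n) c k * v k i j) ->
  (forall k, c k != 0 -> v k = E) -> D = E.
Proof.
move=> c_sum1 DE vE; apply: funext => i; apply: funext => j.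
rewrite DE -[RHS]mul1r -c_sum1 mulr_suml; apply: eq_bigr => k _.
by have [-> | /vE ->] := eqVneq (c k) 0; rewrite ?mul0r.
Qed.

Lemma tight_pure_window (p : nat) (lo hi d : 'I_p.+1 -> int) :
  tight_window lo hi (pure_diagram d) -> lo = d /\ hi = d.
Proof.
move=> tight; split; apply: funext => i; have [lo_i hi_i] := tight i.
  by apply/eqP; apply: contraNT lo_i => /pure_diagram_eq0 ->.
by apply/eqP; apply: contraNT hi_i => /pure_diagram_eq0 ->.
Qed.

(** * Bounds for the multiplicity *)

Theorem proposition2p8 (p : nat) (lo hi : 'I_p.+1 -> int)
    (D : diagram p)
    (lo_incr : strictly_increasing lo)
    (hi_incr : strictly_increasing hi)
    (lo_le_hi : forall i, lo i <= hi i)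
    (lo0 : lo ord0 = 0) (hi0 : hi ord0 = 0)
    (DV : diagram_space lo hi D)
    (Dhull : convex_hull (pure_diagrams lo hi) D) :
  let lower : rat := \prod_(i < p.+1 | i != ord0) (lo i)%:~R in
  let upper : rat := \prod_(i < p.+1 | i != ord0) (hi i)%:~R in
  let e : rat := multiplicity D in
  [/\ lower <= p`!%:R * e <= upper,
      (p`!%:R * e = lower <-> D = pure_diagram lo),
      (p`!%:R * e = upper <-> D = pure_diagram hi)
    & tight_window lo hi D ->
        (p`!%:R * e = lower <-> is_pure D) /\
        (p`!%:R * e = upper <-> is_pure D)].
Proof.
move=> lower upper e.
have [n [c [v [c_ge0 c_sum1 v_pure DE]]]] := Dhull.
have [d dP] := fin_all_exists v_pure.
have d_incr k : strictly_increasing (d k) by have [] := dP k.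
have lo_le k i : lo i <= d k i by have [_ /(_ i) /andP []] := dP k.
have le_hi k i : d k i <= hi i by have [_ /(_ i) /andP []] := dP k.
have vE k : v k = pure_diagram (d k) by have [] := dP k.
have d0 k : d k ord0 = 0.
  apply/eqP; rewrite eq_le; move: (lo_le k ord0) (le_hi k ord0).
  by rewrite lo0 hi0 => -> ->.
have eE : p`!%:R * e =
    \sum_(k < n) c k * \prod_(i < p.+1 | i != ord0) (d k i)%:~R.
  apply: multiplicity_combination => // i j.
  by rewrite DE; under eq_bigr do rewrite vE.
have prod_ge k : lower <= \prod_(i < p.+1 | i != ord0) (d k i)%:~R.
  exact: prod_degrees_le.
have prod_le k : \prod_(i < p.+1 | i != ord0) (d k i)%:~R <= upper.
  exact: prod_degrees_le.
have eq_lower : p`!%:R * e = lower <-> D = pure_diagram lo.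
  split=> [|D_pure]; last by rewrite /e D_pure multiplicity_pure.
  rewrite eE => eq_lo; apply: (combination_same c_sum1 DE) => k ck_neq0.
  rewrite vE; congr pure_diagram; apply/esym/prod_degrees_inj => //.
  exact/esym/(average_eq_min c_ge0 c_sum1 prod_ge eq_lo).
have eq_upper : p`!%:R * e = upper <-> D = pure_diagram hi.
  split=> [|D_pure]; last by rewrite /e D_pure multiplicity_pure.
  rewrite eE => eq_hi; apply: (combination_same c_sum1 DE) => k ck_neq0.
  rewrite vE; congr pure_diagram; apply: prod_degrees_inj => //.
  exact: (average_eq_max c_ge0 c_sum1 prod_le eq_hi).
split=> //; first by rewrite eE average_ge // average_le.
move=> tight; rewrite eq_lower eq_upper.
split; split=> [-> | [f f_incr Df]]; try by [exists lo | exists hi].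
  by have [-> _] : lo = f /\ hi = f by apply: tight_pure_window; rewrite -Df.
by have [_ ->] : lo = f /\ hi = f by apply: tight_pure_window; rewrite -Df.
Qed.
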